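(* Let $H:\mathbb R^n\times\mathbb R^n\to\mathbb R$, $(p,y)\mapsto H(p,y)$, be smooth, $\mathbb Z^n$-periodic in $y$, with $\sup_y|H(0,y)|<\infty$, $\sup_y|D_yH(p,y)|\le C_0(1+|p|)$, and $H(p,y)\to\infty$ as $|p|\to\infty$ uniformly in $y$. Fix $P\in\mathbb R^n$, and for $\theta\in(0,1)$ let $z^{\theta}$ be the ($\mathbb Z^n$-periodic) solution of $\theta z^{\theta}+H(P+Dz^{\theta},y)=\theta^2\Delta z^{\theta}$ in $\mathbb R^n$. Then there is a constant $C>0$ independent of $\theta$ such that $\left|\frac{\partial(\theta z^{\theta})}{\partial\theta}(x)\right|\le C$ for all $x\in\mathbb R^n$.
   Context: The solutions satisfy the standard bounds $\|\theta z^\theta\|_{L^\infty},\|Dz^\theta\|_{L^\infty}\le C$ uniformly in $\theta$, and depend smoothly on $\theta$. *)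

(* Defs.v *)
From HB Require Import structures.
From mathcomp Require Import all_boot all_order all_algebra.
From mathcomp Require Import all_classical all_reals all_analysis.
Set Implicit Arguments. Unset Strict Implicit. Unset Printing Implicit Defensive.
Import Order.TTheory GRing.Theory Num.Theory.
Import numFieldNormedType.Exports.
Local Open Scope classical_set_scope.
Local Open Scope ring_scope.

(* C^k on a set D (intended open): differentiable on D with all directional
   derivatives C^(k-1) on D; C^0 = continuous on D. *)
Fixpoint Ck_on {R : realType} {V : normedModType R} (k : nat) (D : set V)
  (f : V -> R) : Prop :=
  match k with
  | 0 => forall x, D x -> {for x, continuous f}
  | k'.+1 => (forall x, D x -> differentiable f x) /\
             (forall v : V, Ck_on k' D (fun x => 'D_v f x))
  end.

Definition smooth_on {R : realType} {V : normedModType R} (D : set V) (f : V -> R) :=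
  forall k, Ck_on k D f.

Definition e_ {R : realType} {n : nat} (i : 'I_n) : 'rV[R]_n := delta_mx 0 i.

Definition grad {R : realType} {n : nat} (f : 'rV[R]_n -> R) (x : 'rV[R]_n) : 'rV[R]_n :=
  \row_i ('D_(e_ i) f x).
Definition lap {R : realType} {n : nat} (f : 'rV[R]_n -> R) (x : 'rV[R]_n) : R :=
  \sum_(i < n) 'D_(e_ i) ('D_(e_ i) f) x.

Definition enorm {R : realType} {n : nat} (v : 'rV[R]_n) : R :=
  Num.sqrt (\sum_(i < n) v 0 i ^+ 2).

Definition Zn_periodic {R : realType} {n : nat} (f : 'rV[R]_n -> R) :=
  forall (k : 'rV[int]_n) (y : 'rV[R]_n), f (y + map_mx (fun m : int => m%:~R) k) = f y.

(* Main.v *)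
(* Fix [th] and a sign [s], write [w = dz/dth] and let [x0] maximise the periodic
   function [G = s w + |Dz|^2 / 2].  Differentiating the equation at [(th, x0)]
   along the constant direction [U = (s, Dz (th, x0))] makes the transport term
   vanish, because [D_U (D_i z) = D_i G = 0] there, and
   [D_U (Lap z) = Lap G - |D^2 z|^2 <= - |D^2 z|^2].  This good term absorbs
   [2 th s Lap z <= th^2 |D^2 z|^2 + n], so [th s w <= C - s z(x0)] everywhere.
   Finally [z] itself is not bounded, but its oscillation is, by periodicity and
   the gradient bound, so [s d(th z)/dth = s z + th s w] is bounded above. *)
Require Import Defs.
From HB Require Import structures.
From mathcomp Require Import all_boot all_order all_algebra.
From mathcomp Require Import all_classical all_reals all_analysis.
From mathcomp Require Import ring lra.
Import Order.TTheory GRing.Theory Num.Theory.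
Import numFieldNormedType.Exports.
Local Open Scope classical_set_scope.
Local Open Scope ring_scope.

(** * Calculus along lines: mean value theorem and tests at a maximum *)

Lemma is_derive_line (R : numFieldType) (V W : normedModType R) (f : V -> W)
    (a v : V) (t : R) :
  derivable f (t *: v + a) v ->
  is_derive t 1 (fun h : R => f (h *: v + a)) ('D_v f (t *: v + a)).
Proof.
have E : (fun h : R => h^-1 *: (((fun h => f (h *: v + a)) \o shift t) (h *: 1)
    - f (t *: v + a))) =
  (fun h : R => h^-1 *: ((f \o shift (t *: v + a)) (h *: v) - f (t *: v + a))).
  by apply/funext => h /=; rewrite [_%:A]mulr1 scalerDl addrA.
by move=> df; split; rewrite /derivable /derive E.
Qed.

Lemma line_MVT (R : realType) (V : normedModType R) (f : V -> R) (a v : V)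
    (h : R) : 0 < h ->
  (forall t, 0 <= t <= h -> derivable f (t *: v + a) v) ->
  exists2 t, 0 < t < h & f (h *: v + a) - f a = h * 'D_v f (t *: v + a).
Proof.
move=> h0 df.
have [||t] := @MVT R (fun t => f (t *: v + a)) (fun t => 'D_v f (t *: v + a))
    0 h h0.
- move=> x; rewrite in_itv /= => /andP[x0 xh].
  by apply/is_derive_line/df; rewrite !ltW.
- apply: derivable_within_continuous => x; rewrite in_itv /= => xh.
  exact/ex_derive/is_derive_line/df.
by rewrite in_itv /= scale0r add0r subr0 mulrC => th E; exists t.
Qed.

Lemma derive_max (R : realType) (V : normedModType R) (f : V -> R) (a v : V) :
  (forall t : R, derivable f (t *: v + a) v) ->
  (forall t : R, f (t *: v + a) <= f a) -> 'D_v f a = 0.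
Proof.
move=> df fmax.
have a0 : (0 : R) *: v + a = a by rewrite scale0r add0r.
have := @derive1_at_max R (fun t => f (t *: v + a)) (-1) 1 0.
case=> //.
- by move=> t _; exact/ex_derive/is_derive_line.
- by rewrite in_itv /= ltrN10 ltr01.
- by move=> t _; rewrite a0.
move=> _ /=; have [_ ->] := @is_derive_line R V R f a v 0 (df 0).
by rewrite a0.
Qed.

(** If the second derivative were positive, the first one, which vanishes at [a], would be positive
    just after [a]. The mean value theorem would then make [f] exceed its maximum. *)
Lemma derive2_max (R : realType) (V : normedModType R) (f : V -> R) (a v : V) :
  (forall t : R, derivable f (t *: v + a) v) -> derivable ('D_v f) a v ->
  (forall t : R, f (t *: v + a) <= f a) -> 'D_v ('D_v f) a <= 0.
Proof.
move=> df ddf fmax; rewrite leNgt; apply/negP => L0.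
have Dfa : 'D_v f a = 0 by exact: derive_max.
have cv : h^-1 *: ('D_v f (h *: v + a) - 'D_v f a) @[h --> 0^']
    --> 'D_v ('D_v f) a by exact: ddf.
(* The tolerance is the limit itself: a quotient closer to it than its own size is positive. *)
move/cvgrPdist_lt : cv => /(_ _ L0); rewrite Dfa => -[d /= d0 dP].
have d20 : 0 < d / 2 by rewrite divr_gt0.
have [t /andP[t0 td] E] := @line_MVT R V f a v _ d20 (fun t _ => df t).
have := fmax (d / 2); rewrite -subr_le0 E pmulr_rle0// leNgt => /negP; apply.
have := dP t; rewrite /ball_ /= sub0r normrN gtr0_norm//.
have -> : t < d by rewrite (lt_trans td)// ltr_pdivrMr// ltr_pMr// ltr1n.
move=> /(_ erefl (lt0r_neq0 t0)); rewrite subr0 => /(le_lt_trans (ler_norm _)).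
rewrite ltrBlDr ltrDl.
by rewrite (pmulr_rgt0 _ _) // invr_gt0.
Qed.

(** * Symmetry of mixed second derivatives *)

(** The second difference over a parallelogram is the increment along [u] of [f (h *: v + x) - f x].
    The mean value theorem along [u], then along [v] for ['D_u f], produces the two factors [h]. *)
Lemma rectangle_MVT (R : realType) (V : normedModType R) (D : set V)
    (f : V -> R) (a u v : V) (h : R) : 0 < h -> Ck_on 2 D f ->
  (forall s t, 0 <= s <= h -> 0 <= t <= h -> D (t *: v + (s *: u + a))) ->
  exists s t, [/\ 0 <= s <= h, 0 <= t <= h &
    f (h *: v + (h *: u + a)) - f (h *: u + a) - (f (h *: v + a) - f a)
    = h * (h * 'D_v ('D_u f) (t *: v + (s *: u + a)))].
Proof.
move=> h0 [df cf] Dst.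
have hh : 0 <= h <= h by rewrite ltW/=.
have h00 : 0 <= (0 : R) <= h by rewrite lexx ltW.
have D0 s : 0 <= s <= h -> D (s *: u + a).
  by move=> sh; have := Dst s 0 sh h00; rewrite scale0r add0r.
have is1 s : 0 <= s <= h ->
    is_derive (s *: u + a) u (fun x => f (h *: v + x) - f x)
      ('D_u f (h *: v + (s *: u + a)) - 'D_u f (s *: u + a)).
  move=> sh; apply: is_deriveB; last first.
    exact/derivableP/diff_derivable/df/D0.
  have E : (fun k : R => k^-1 *: (((fun x => f (h *: v + x)) \o
      shift (s *: u + a)) (k *: u) - f (h *: v + (s *: u + a)))) =
    (fun k : R => k^-1 *: ((f \o shift (h *: v + (s *: u + a))) (k *: u)
      - f (h *: v + (s *: u + a)))).
    by apply/funext => k /=; rewrite (addrCA (h *: v)).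
  have := @diff_derivable _ _ _ f (h *: v + (s *: u + a)) u (df _ (Dst _ _ sh hh)).
  by move=> dd; split; rewrite /derivable /derive E.
have [|s /andP[s0 sh] E1] := @line_MVT R V (fun x => f (h *: v + x) - f x) a u h h0.
  by move=> t /is1 ?; exact: ex_derive.
have sh' : 0 <= s <= h by rewrite !ltW.
have [|t /andP[t0 th] E2] := @line_MVT R V ('D_u f) (s *: u + a) v h h0.
  by move=> t th; apply/diff_derivable; apply: (cf u).1; exact: Dst.
exists s, t; rewrite !ltW //; split => //.
by rewrite E1 (derive_val (is_derive := is1 s sh')) E2.
Qed.

(** The second difference is symmetric in [u] and [v], so [rectangle_MVT] in either order equates
    the two mixed derivatives at two nearby points. Continuity moves both values to [a] at a cost of
    [e / 2] each. *)
Lemma derive_comm (R : realType) (V : normedModType R) (D : set V)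
    (f : V -> R) (a u v : V) : open D -> Ck_on 2 D f -> D a ->
  'D_v ('D_u f) a = 'D_u ('D_v f) a.
Proof.
move=> oD cf Da; apply/eqP; rewrite -subr_eq0 -normr_le0.
apply/ler_addgt0Pr => e e0; rewrite add0r.
have e20 : 0 < e / 2 by rewrite divr_gt0.
have /cvgrPdist_lt /(_ _ e20) c1 := (cf.2 u).2 v a Da.
have /cvgrPdist_lt /(_ _ e20) c2 := (cf.2 v).2 u a Da.
have : \forall x \near a, [/\ D x, `|'D_v ('D_u f) a - 'D_v ('D_u f) x| < e / 2
    & `|'D_u ('D_v f) a - 'D_u ('D_v f) x| < e / 2].
  have nD : nbhs a D by exact: open_nbhs_nbhs.
  exact: filterS3 (fun x => @And3 _ _ _) nD c1 c2.
move=> /nbhs_ballP[r /= r0 rP].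
(* The parallelogram then has diameter at most [h * (|u| + |v|) < r]; the added 1 makes this strict
   and the denominator nonzero. *)
pose h := r / (`|u| + `|v| + 1).
have uv0 : 0 < `|u| + `|v| + 1 by rewrite ltr_wpDl// addr_ge0.
have h0 : 0 < h by rewrite divr_gt0.
have near_a s t : 0 <= s <= h -> 0 <= t <= h -> ball a r (t *: v + (s *: u + a)).
  move=> /andP[s0 sh] /andP[t0 th].
  rewrite -ball_normE /ball_ /= !opprD addrC -!addrA addNr addr0 -opprD normrN.
  apply: (le_lt_trans (ler_normD _ _)); rewrite !normrZ !ger0_norm//.
  apply: (@le_lt_trans _ _ (h * (`|u| + `|v|))).
    by rewrite mulrDr addrC lerD// ler_wpM2r.
  have -> : r = h * (`|u| + `|v| + 1) by rewrite divfK// gt_eqF.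
  by rewrite ltr_pM2l// ltrDl.
have near_a' s t : 0 <= s <= h -> 0 <= t <= h -> ball a r (s *: u + (t *: v + a)).
  by move=> sh th; rewrite addrCA; exact: near_a.
have [|s [t [sh th E]]] := @rectangle_MVT R V D f a u v h h0 cf.
  by move=> s t sh th; have [] := rP _ (near_a s t sh th).
have [|s' [t' [sh' th' E']]] := @rectangle_MVT R V D f a v u h h0 cf.
  by move=> s' t' sh' th'; have [] := rP _ (near_a' t' s' th' sh').
have swap x1 x2 x3 x4 : x1 - x2 - (x3 - x4) = x1 - x3 - (x2 - x4) :> R.
  by ring.
have EE : 'D_v ('D_u f) (t *: v + (s *: u + a)) =
    'D_u ('D_v f) (t' *: u + (s' *: v + a)).
  apply: (mulfI (lt0r_neq0 h0)); apply: (mulfI (lt0r_neq0 h0)).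
  apply: (etrans (esym E)); apply: etrans E'.
  by rewrite (addrCA (h *: v)) swap.
have [_ h1 _] := rP _ (near_a s t sh th).
have [_ _ h2] := rP _ (near_a' t' s' th' sh').
rewrite [leRHS]splitr.
apply: le_trans (ler_distD ('D_v ('D_u f) (t *: v + (s *: u + a))) _ _) _.
apply: lerD; first exact: ltW h1.
by rewrite EE distrC; exact: ltW h2.
Qed.

(** * Coordinates, periodic functions and the Euclidean norm *)

Lemma derive_coord (R : realType) (n : nat) (f : 'rV[R]_n -> R)
    (x v : 'rV[R]_n) :
  differentiable f x -> 'D_v f x = \sum_(i < n) v 0 i * 'D_(e_ i) f x.
Proof.
move=> df; rewrite deriveE// [in LHS](row_sum_delta v) linear_sum.
by apply: eq_bigr => i _; rewrite linearZ/= deriveE.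
Qed.

Lemma Zn_shift_unit_box (R : realType) (n : nat) (y : 'rV[R]_n) :
  exists k : 'rV[int]_n,
    forall i, 0 <= (y + map_mx (fun m : int => m%:~R) k) 0 i <= 1.
Proof.
exists (\row_i - Num.floor (y 0 i)) => i; rewrite !mxE mulrNz subr_ge0.
by rewrite floor_le lerBlDl -(intrD _ _ 1) addrC ltW// addrC floorD1_gt.
Qed.

(** Every point is an integer translate of a point of the compact unit cube, so a maximum over the
    cube is global. *)
Lemma Zn_periodic_max (R : realType) (n : nat) (f : 'rV[R]_n -> R) :
  continuous f -> Zn_periodic f -> exists c, forall x, f x <= f c.
Proof.
move=> cf pf.
have cA := @rV_compact R n (fun=> `[0, 1]%classic) (fun=> @segment_compact R 0 1).
have [||c _ cmax] := compact_EVT_max _ cA (f := f).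
- by exists 0 => i; rewrite /= mxE in_itv /= lexx ler01.
- exact: continuous_subspaceT.
exists c => x; have [k kP] := @Zn_shift_unit_box R n x.
rewrite -(pf k); apply: cmax; rewrite inE /= => i.
by rewrite in_itv /= kP.
Qed.

(** Translating [x] by an integer vector keeps [f x] and puts the displacement from [y] into the
    unit cube. The mean value theorem then costs at most [C] per coordinate. *)
Lemma Zn_periodic_osc (R : realType) (n : nat) (f : 'rV[R]_n -> R) (C : R) :
  (forall x, differentiable f x) -> Zn_periodic f ->
  (forall x i, `|'D_(e_ i) f x| <= C) ->
  forall x y, f x - f y <= n%:R * C.
Proof.
move=> df pf fC x y.
have [k kP] := @Zn_shift_unit_box R n (x - y).
set r := _ + _ in kP.
have [|t _] := @line_MVT R _ f y r 1 ltr01.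
  by move=> t _; exact/diff_derivable.
have -> : 1 *: r + y = x + map_mx (fun m : int => m%:~R) k.
  by rewrite scale1r /r addrAC subrK.
rewrite pf mul1r derive_coord// => ->.
rewrite (le_trans (ler_norm _))// (le_trans (ler_norm_sum _ _ _))//.
have -> : n%:R * C = \sum_(i < n) C by rewrite sumr_const card_ord mulr_natl.
apply: ler_sum => i _; rewrite normrM -[leRHS]mul1r ler_pM//.
by have /andP[r0 r1] := kP i; rewrite ger0_norm.
Qed.

Lemma le_enorm (R : realType) (n : nat) (v : 'rV[R]_n) i : `|v 0 i| <= enorm v.
Proof.
rewrite /enorm -sqrtr_sqr ler_wsqrtr// (bigD1 i)//= lerDl sumr_ge0// => j _.
exact: sqr_ge0.
Qed.

Lemma enorm_le (R : realType) (n : nat) (v : 'rV[R]_n) (M : R) :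
  (forall i, `|v 0 i| <= M) -> enorm v <= Num.sqrt (n%:R * M ^+ 2).
Proof.
move=> vM; rewrite /enorm ler_wsqrtr//.
have -> : n%:R * M ^+ 2 = \sum_(i < n) M ^+ 2.
  by rewrite sumr_const card_ord mulr_natl.
apply: ler_sum => i _; rewrite -[v 0 i ^+ 2]real_normK ?num_real// ler_sqr ?nnegrE//.
exact: le_trans (normr_ge0 _) (vM i).
Qed.

(** * Derivatives on products and on the space-time strip *)

Lemma derive_pair_r (R : realType) (U V W : normedModType R) (f : U * V -> W)
    (a : U) (x v : V) :
  'D_v (fun y => f (a, y)) x = 'D_((0 : U, v)) f (a, x).
Proof.
have E : (fun h : R => h^-1 *: (((fun y => f (a, y)) \o shift x) (h *: v)
      - f (a, x))) =
    (fun h : R => h^-1 *: ((f \o shift (a, x)) (h *: (0 : U, v)) - f (a, x))).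
  apply/funext => h; congr (_ *: (f _ - _)).
  by rewrite /= -[RHS]/(h *: 0 + a, h *: v + x) scaler0 add0r.
by rewrite /derive E.
Qed.

Lemma is_derive_pair_l (R : realType) (U V W : normedModType R)
    (f : U * V -> W) (a v : U) (x : V) : derivable f (a, x) (v, 0 : V) ->
  is_derive a v (fun b => f (b, x)) ('D_((v, 0 : V)) f (a, x)).
Proof.
have E : (fun h : R => h^-1 *: (((fun b => f (b, x)) \o shift a) (h *: v)
      - f (a, x))) =
    (fun h : R => h^-1 *: ((f \o shift (a, x)) (h *: (v, 0 : V)) - f (a, x))).
  apply/funext => h; congr (_ *: (f _ - _)).
  by rewrite /= -[RHS]/(h *: v + a, h *: 0 + x) scaler0 add0r.
by move=> df; split; rewrite /derivable /derive E.
Qed.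

Lemma Zn_periodic_derive (R : realType) (n : nat) (f : 'rV[R]_n -> R)
    (v : 'rV[R]_n) : Zn_periodic f -> Zn_periodic ('D_v f).
Proof.
move=> pf k y; set K := map_mx _ _.
have E : (fun h : R => h^-1 *: ((f \o shift (y + K)) (h *: v) - f (y + K))) =
    (fun h : R => h^-1 *: ((f \o shift y) (h *: v) - f y)).
  by apply/funext => h; rewrite /= addrA !pf.
by rewrite /derive E.
Qed.

Lemma open_unit_strip (R : realType) (n : nat) :
  open [set q : R * 'rV[R]_n | 0 < q.1 < 1].
Proof.
have -> : [set q : R * 'rV[R]_n | 0 < q.1 < 1] = fst @^-1` `]0, 1[%classic.
  by apply/seteqP; split => q /=; rewrite in_itv.
by apply: open_comp; [move=> q _; exact: cvg_fst|exact: interval_open].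
Qed.

Lemma smooth_on_derive (R : realType) (V : normedModType R) (D : set V)
    (f : V -> R) (v : V) : smooth_on D f -> smooth_on D ('D_v f).
Proof. by move=> sf k; exact: (sf k.+1).2. Qed.

Lemma smooth_on_differentiable (R : realType) (V : normedModType R)
    (D : set V) (f : V -> R) (x : V) :
  smooth_on D f -> D x -> differentiable f x.
Proof. by move=> sf; exact: (sf 1%N).1. Qed.

(** Derivatives are local, so identities valid only on the open strip, the equation among them, can
    be differentiated. *)
Lemma derive_eq_on (R : realType) (V : normedModType R) (D : set V)
    (f g : V -> R) (x v : V) : open D -> {in D, f =1 g} -> D x ->
  'D_v f x = 'D_v g x.
Proof.
move=> oD fg Dx; apply: near_eq_derive; apply: filterS (open_nbhs_nbhs _).
  by move=> y Dy; apply: fg; rewrite inE; exact: Dy.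
by split.
Qed.

(** Symmetry is applied twice: first to ['D_u f], then to [f] under the outer ['D_u]. *)
Lemma derive_comm3 (R : realType) (V : normedModType R) (D : set V)
    (f : V -> R) (x u v : V) : open D -> smooth_on D f -> D x ->
  'D_v ('D_u ('D_u f)) x = 'D_u ('D_u ('D_v f)) x.
Proof.
move=> oD sf Dx.
apply: (etrans (derive_comm _ _ D _ x u v oD (smooth_on_derive _ _ _ _ u sf 2) Dx)).
apply: (derive_eq_on _ _ _ _ _ _ _ oD _ Dx) => y; rewrite inE => Dy.
exact: (derive_comm _ _ D _ _ _ _ oD (sf 2%N) Dy).
Qed.

Lemma derive_spacetime (R : realType) (n : nat) (f : R * 'rV[R]_n -> R)
    (q : R * 'rV[R]_n) (s : R) (a : 'rV[R]_n) : differentiable f q ->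
  'D_((s, a)) f q = s * 'D_((1, 0)) f q + \sum_i a 0 i * 'D_((0, e_ i)) f q.
Proof.
move=> df; rewrite !deriveE//.
have -> : (s, a) = s *: ((1, 0) : R * 'rV[R]_n) + \sum_i a 0 i *: (0, e_ i).
  apply/pair_equal_spec; split=> /=.
    by rewrite raddf_sum /= big1 ?addr0 ?[s *: 1]mulr1// => i _; rewrite scaler0.
  by rewrite raddf_sum /= scaler0 add0r [LHS]row_sum_delta.
rewrite linearD linearZ linear_sum; congr (_ + _); apply: eq_bigr => i _.
by rewrite linearZ deriveE.
Qed.

(** The common shape of the auxiliary function [G] (with [B k] half of [C k]) and of its space
    derivatives [G']. *)
Lemma is_derive_lincomb (R : realType) (n : nat) (V : normedModType R)
    (s : R) (A : V -> R) (B C : 'I_n -> V -> R) (q v : V) :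
  derivable A q v -> (forall k, derivable (B k) q v) ->
  (forall k, derivable (C k) q v) ->
  is_derive q v (fun q => s * A q + \sum_k B k q * C k q)
    (s * 'D_v A q + \sum_k (B k q * 'D_v (C k) q + C k q * 'D_v (B k) q)).
Proof.
move=> dA dB dC.
have -> : (fun q => s * A q + \sum_k B k q * C k q) =
    s *: A + \sum_k (B k * C k).
  apply/funext => y /=; rewrite fct_sumE.
  by [].
apply: is_deriveD.
  by apply: is_deriveZ; exact: derivableP.
apply: is_derive_sum => k.
exact: (is_deriveM (derivableP (dB k)) (derivableP (dC k))).
Qed.

Lemma is_derive_fst (R : realType) (V : normedModType R) (q v : R * V) :
  is_derive q v (fun q => q.1) v.1.
Proof.
have cf : continuous (fst : R * V -> R) by move=> x; exact: cvg_fst.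
have df : differentiable (fst : R * V -> R) q by exact: linear_differentiable.
by split; [exact: diff_derivable|rewrite deriveE// diff_lin].
Qed.

(** This removes the transport term: by the chain rule, if the momentum is stationary along [U],
    only the explicit dependence of [H] on [y] contributes. *)
Lemma derive_stationary_comp (R : realType) (n : nat)
    (H : 'rV[R]_n -> 'rV[R]_n -> R) (P : 'rV[R]_n)
    (g : 'I_n -> R * 'rV[R]_n -> R) (q U : R * 'rV[R]_n) :
  smooth_on setT (fun q : 'rV[R]_n * 'rV[R]_n => H q.1 q.2) ->
  (forall i, differentiable (g i) q) -> (forall i, 'D_U (g i) q = 0) ->
  is_derive q U (fun q => H (P + \row_i g i q) q.2)
    (\sum_i U.2 0 i * 'D_(e_ i) (H (P + \row_i g i q)) q.2).
Proof.
move=> sH dg g0.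
pose gg := fun q => P + \row_i g i q.
have dgg : differentiable gg q.
  have -> : gg = cst P + \sum_i (fun q => g i q *: (e_ i : 'rV[R]_n)).
    apply/funext => y; rewrite /gg [RHS]/(_ + (\sum_i _) _) fct_sumE.
    congr (_ + _); rewrite [LHS]row_sum_delta; apply: eq_bigr => i _.
    by rewrite mxE.
  apply: differentiableD => //; apply: differentiable_sum => i.
  exact: differentiableZl.
have dgg0 : 'd gg q U = 0.
  rewrite -deriveE// derive_mx; last exact: diff_derivable.
  apply/matrixP => i j; rewrite !mxE -[RHS](g0 j).
  have -> : (fun t => gg t i j) = cst (P i j) + g j.
    by apply/funext => y /=; rewrite !mxE.
  by rewrite deriveD ?derive_cst ?add0r//; exact: diff_derivable.
have cs : continuous (snd : R * 'rV[R]_n -> _) by move=> x; exact: cvg_snd.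
have ds : differentiable (snd : R * 'rV[R]_n -> _) q.
  exact: linear_differentiable.
pose F := fun q : 'rV[R]_n * 'rV[R]_n => H q.1 q.2.
have dF : differentiable F (gg q, q.2) by exact: (smooth_on_differentiable _ _ _ _ _ sH).
have dG : differentiable (fun q => (gg q, q.2)) q.
  exact: differentiable_pair.
have dFG : differentiable (F \o (fun q => (gg q, q.2))) q.
  exact: differentiable_comp.
have -> : (fun q => H (P + \row_i g i q) q.2) =
  F \o (fun q : R * 'rV[R]_n => (gg q, q.2)) by [].
split; first exact: diff_derivable.
rewrite deriveE// diff_comp//= diff_pair//=.
have dsU : 'd (snd : R * 'rV[R]_n -> _) q U = U.2 by rewrite diff_lin.
have dE : ('d gg q U, 'd (snd : R * 'rV[R]_n -> _) q U) = (0, U.2).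
  by congr pair.
apply: etrans (congr1 ('d F (gg q, q.2)) dE) _.
have dHp : differentiable (H (gg q)) q.2.
  have -> : H (gg q) = F \o (fun y => (gg q, y)) by [].
  by apply: differentiable_comp => //; exact: differentiable_pair.
apply: etrans (derive_coord _ _ _ _ _ dHp).
apply: etrans (esym (derive_pair_r _ _ _ _ F (gg q) q.2 U.2)).
exact: esym (deriveE _ dF).
Qed.

(** * The Bernstein estimate at a maximum point *)

(** The equation differentiated along [U] leaves [th * 'D_U f], whose expansion gives the first two
    terms, and the lower-order terms. The right-hand side is at most 1 per coordinate, hence the
    bound [n]. *)
Lemma bernstein_at_max (R : realType) (n : nat)
    (H : 'rV[R]_n -> 'rV[R]_n -> R) (P : 'rV[R]_n) (f : R * 'rV[R]_n -> R)
    (s th : R) (x : 'rV[R]_n) :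
  let T := (1, 0) : R * 'rV[R]_n in
  let X i := (0, e_ i) : R * 'rV[R]_n in
  let D := [set q : R * 'rV[R]_n | 0 < q.1 < 1] in
  smooth_on setT (fun q : 'rV[R]_n * 'rV[R]_n => H q.1 q.2) ->
  smooth_on D f ->
  (forall q, D q -> q.1 * f q + H (P + \row_i 'D_(X i) f q) q.2 =
     q.1 * q.1 * \sum_i 'D_(X i) ('D_(X i) f) q) ->
  s * s = 1 -> 0 < th < 1 ->
  (forall y, s * 'D_T f (th, y) +
       \sum_k 2^-1 * 'D_(X k) f (th, y) * 'D_(X k) f (th, y)
     <= s * 'D_T f (th, x) +
       \sum_k 2^-1 * 'D_(X k) f (th, x) * 'D_(X k) f (th, x)) ->
  th * (s * 'D_T f (th, x))
  + th * \sum_k 'D_(X k) f (th, x) * 'D_(X k) f (th, x)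
  + s * f (th, x) + \sum_k 'D_(X k) f (th, x) *
      'D_(e_ k) (H (P + \row_i 'D_(X i) f (th, x))) x <= n%:R.
Proof.
move=> T X D sH sf pde s2 th01 Gmax.
have oD : open D by exact: open_unit_strip.
have split_dir g q a : differentiable g q -> 'D_((s, a)) g q =
    s * 'D_T g q + \sum_k a 0 k * 'D_(X k) g q by exact: derive_spacetime.
have line i t : t *: X i + (th, x) = (th, t *: e_ i + x).
  by congr pair; rewrite /= scaler0 add0r.
(* With their bodies visible, unifying [T] with [X i] would try to convert the
   real numbers [1] and [0], which diverges. *)
clearbody T X.
set q0 := (th, x) in line *.
have Dq0 : D q0 by [].
(* The coefficients are frozen at [q0], so [U] is a constant direction and ['D_U] commutes with the
   space derivatives. *)
pose a : 'rV[R]_n := \row_k 'D_(X k) f q0.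
pose U : R * 'rV[R]_n := (s, a).
have sd v : smooth_on D ('D_v f) by exact: smooth_on_derive.
have sdd u v : smooth_on D ('D_u ('D_v f)) by exact: smooth_on_derive.
have der g q v : smooth_on D g -> D q -> derivable g q v.
  by move=> sg Dq; apply/diff_derivable/(smooth_on_differentiable _ _ _ _ _ sg Dq).
have dU g : smooth_on D g ->
    'D_U g q0 = s * 'D_T g q0 + \sum_k 'D_(X k) f q0 * 'D_(X k) g q0.
  move=> sg; rewrite /U split_dir.
    by congr (_ + _); apply: eq_bigr => k _; rewrite mxE.
  exact: (smooth_on_differentiable _ _ _ _ _ sg Dq0).
have comm u v q : D q -> 'D_u ('D_v f) q = 'D_v ('D_u f) q.
  by move=> Dq; exact: (derive_comm _ _ D _ q v u oD (sf 2%N) Dq).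
pose G q := s * 'D_T f q + \sum_k 2^-1 * 'D_(X k) f q * 'D_(X k) f q.
pose G' i q := s * 'D_(X i) ('D_T f) q +
  \sum_k 'D_(X k) f q * 'D_(X i) ('D_(X k) f) q.
have dG i q : D q -> is_derive q (X i) G (G' i q).
  move=> Dq; apply: (@is_derive_eq _ _ _ _ _ _ _ (s * 'D_(X i) ('D_T f) q +
    \sum_k (2^-1 * 'D_(X k) f q * 'D_(X i) ('D_(X k) f) q +
    'D_(X k) f q * 'D_(X i) (fun q => 2^-1 * 'D_(X k) f q) q))).
    apply: is_derive_lincomb => [|k|k]; [exact: der| |exact: der].
    exact/derivableZ/der.
  rewrite /G'; congr (_ + _); apply: eq_bigr => k _.
  have -> : 'D_(X i) (fun q => 2^-1 * 'D_(X k) f q) q =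
      2^-1 * 'D_(X i) ('D_(X k) f) q by apply: deriveZ; exact: der.
  lra.
(* A space direction leaves [th] fixed, so the whole line stays in the strip and [Gmax] applies
   along it. *)
have Dline i t : D (t *: X i + q0) by rewrite line.
have Gline i t : G (t *: X i + q0) <= G q0.
  by rewrite line; exact: Gmax.
have DG i : 'D_(X i) G q0 = 0.
  by apply: derive_max => t; [exact: (@ex_derive _ _ _ _ _ _ _ (dG i _ (Dline i t)))|exact: Gline].
have DGE i q : D q -> 'D_(X i) G q = G' i q.
  by move=> Dq; exact: (@derive_val _ _ _ _ _ _ _ (dG i q Dq)).
(* After exchanging derivatives, ['D_U ('D_(X i) f)] is ['D_(X i) G], which vanishes at the
   maximum. *)
have DDf i : 'D_U ('D_(X i) f) q0 = 0.
  apply: etrans (etrans (esym (DGE i _ Dq0)) (DG i)).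
  apply: (etrans (dU ('D_(X i) f) (sd (X i)))).
  apply: (congr2 +%R); first exact: (congr1 ( *%R s) (comm T (X i) q0 Dq0)).
  by apply: eq_bigr => k _; exact: congr1 (comm (X k) (X i) q0 Dq0).
have dG' i : is_derive q0 (X i) (G' i) (s * 'D_(X i) ('D_(X i) ('D_T f)) q0 +
  \sum_k ('D_(X k) f q0 * 'D_(X i) ('D_(X i) ('D_(X k) f)) q0 +
          'D_(X i) ('D_(X k) f) q0 * 'D_(X i) ('D_(X k) f) q0)).
  by apply: is_derive_lincomb => [|k|k]; exact: der.
(* The formula [G'] holds only in the strip; agreement near [q0] is what a second differentiation
   requires. *)
have nearG' i : \forall q \near q0, 'D_(X i) G q = G' i q.
  by apply: filterS (DGE i) _; exact: open_nbhs_nbhs.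
have DDG i : s * 'D_(X i) ('D_(X i) ('D_T f)) q0 +
  \sum_k ('D_(X k) f q0 * 'D_(X i) ('D_(X i) ('D_(X k) f)) q0 +
          'D_(X i) ('D_(X k) f) q0 * 'D_(X i) ('D_(X k) f) q0) <= 0.
  rewrite -(@derive_val _ _ _ _ _ _ _ (dG' i)) -(near_eq_derive _ (nearG' i)).
  apply: derive2_max => [t||t].
  - exact: (@ex_derive _ _ _ _ _ _ _ (dG i _ (Dline i t))).
  - apply: (near_eq_derivable _ (@ex_derive _ _ _ _ _ _ _ (dG' i))).
    by apply: filterS (nearG' i) => q /esym.
  - exact: Gline.
have DUlap i : 'D_U ('D_(X i) ('D_(X i) f)) q0 <=
    - ('D_(X i) ('D_(X i) f) q0 * 'D_(X i) ('D_(X i) f) q0).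
  have comm3 v : 'D_v ('D_(X i) ('D_(X i) f)) q0 =
      'D_(X i) ('D_(X i) ('D_v f)) q0.
    exact: (derive_comm3 _ _ D _ q0 (X i) v oD sf Dq0).
  have -> : 'D_U ('D_(X i) ('D_(X i) f)) q0 =
      s * 'D_(X i) ('D_(X i) ('D_T f)) q0 +
      \sum_k 'D_(X k) f q0 * 'D_(X i) ('D_(X i) ('D_(X k) f)) q0.
    apply: (etrans (dU ('D_(X i) ('D_(X i) f)) (sdd (X i) (X i)))).
    apply: (congr2 +%R); first exact: (congr1 ( *%R s) (comm3 T)).
    by apply: eq_bigr => k _; exact: congr1 (comm3 (X k)).
  rewrite -subr_le0 opprK; apply: le_trans (DDG i).
  rewrite big_split/= [leRHS]addrA; apply: lerD; first exact: lexx.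
  (* Among the squares of the mixed derivatives only the diagonal one, [k = i], is kept. *)
  rewrite (bigD1 i)//= lerDl; apply: sumr_ge0 => k _.
  by rewrite -expr2 sqr_ge0.
have DUf : 'D_U f q0 = s * 'D_T f q0 + \sum_k 'D_(X k) f q0 * 'D_(X k) f q0.
  exact: dU.
have dH := derive_stationary_comp R n H P (fun i => 'D_(X i) f) q0 U sH
  (fun i => smooth_on_differentiable _ _ _ _ _ (sd (X i)) Dq0) DDf.
have dfst := is_derive_fst R _ q0 U.
have dL : is_derive q0 U (fun q => q.1 * f q + H (P + \row_i 'D_(X i) f q) q.2)
    (th * 'D_U f q0 + f q0 * s + \sum_i U.2 0 i *
      'D_(e_ i) (H (P + \row_i 'D_(X i) f q0)) x).
  apply: is_deriveD; apply: is_deriveM.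
  by apply: derivableP; exact: der.
have dR : is_derive q0 U (fun q => q.1 * q.1 * \sum_i 'D_(X i) ('D_(X i) f) q)
    (th * th * (\sum_i 'D_U ('D_(X i) ('D_(X i) f)) q0) +
     (\sum_i 'D_(X i) ('D_(X i) f) q0) * (th * s + th * s)).
  apply: (is_deriveM (is_deriveM dfst dfst)).
  have -> : (fun q => \sum_i 'D_(X i) ('D_(X i) f) q) =
    \sum_i ('D_(X i) ('D_(X i) f)) by apply/funext => q; rewrite fct_sumE.
  by apply: is_derive_sum => i; apply: derivableP; exact: der.
(* Both sides of the equation are differentiated along [U] at [q0]. *)
have E : th * 'D_U f q0 + f q0 * s + \sum_i U.2 0 i *
      'D_(e_ i) (H (P + \row_i 'D_(X i) f q0)) x =
    th * th * (\sum_i 'D_U ('D_(X i) ('D_(X i) f)) q0) +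
     (\sum_i 'D_(X i) ('D_(X i) f) q0) * (th * s + th * s).
  rewrite -(@derive_val _ _ _ _ _ _ _ dL) -(@derive_val _ _ _ _ _ _ _ dR).
  apply: (derive_eq_on _ _ D _ _ q0 U oD _ Dq0) => q; rewrite inE => Dq.
  exact: pde.
have -> : \sum_k 'D_(X k) f q0 *
    'D_(e_ k) (H (P + \row_i 'D_(X i) f q0)) x = \sum_i U.2 0 i *
      'D_(e_ i) (H (P + \row_i 'D_(X i) f q0)) x.
  by apply: eq_bigr => k _; rewrite mxE.
rewrite -mulrDr -DUf mulrC (mulrC s).
have -> : n%:R = \sum_(i < n) (1 : R) by rewrite sumr_const card_ord.
rewrite (mulrC _ th) E mulr_sumr mulr_suml -big_split/=.
apply: ler_sum => i _; move: (DUlap i).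
set y := 'D_(X i) _ _; set l := 'D_U _ _; clearbody y l => ly.
have : th * th * l <= th * th * - (y * y) by rewrite ler_wpM2l// -expr2 sqr_ge0.
(* Completing the square with [s * s = 1] gives [th^2 * l + 2 * th * s * y <= 1 - (th * y - s)^2 <=
   1]. *)
have : 0 <= (th * y - s) ^+ 2 by exact: sqr_ge0.
by move: s2; clear; rewrite expr2; lra.
Qed.

(** * From the maximum point to a uniform bound *)

Lemma differentiable_pair_r (R : realType) (U V W : normedModType R)
    (f : U * V -> W) (a : U) (x : V) :
  differentiable f (a, x) -> differentiable (fun y => f (a, y)) x.
Proof.
move=> df; have -> : (fun y => f (a, y)) = f \o (fun y => (a, y)) by [].
by apply: differentiable_comp => //; exact: differentiable_pair.
Qed.

(** The three terms come from the Bernstein estimate, from the product of [Dz] with the [y]-gradient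
    of [H], and from the oscillation of [z th] between [x] and the maximum point. *)
Lemma one_sided_bound (R : realType) (n : nat)
    (H : 'rV[R]_n -> 'rV[R]_n -> R) (P : 'rV[R]_n) (z : R -> 'rV[R]_n -> R)
    (C L s th : R) :
  smooth_on setT (fun q : 'rV[R]_n * 'rV[R]_n => H q.1 q.2) ->
  smooth_on [set q : R * 'rV[R]_n | 0 < q.1 < 1] (fun q => z q.1 q.2) ->
  (forall th : R, 0 < th < 1 -> Zn_periodic (z th)) ->
  (forall th : R, 0 < th < 1 -> forall y,
     th * z th y + H (P + grad (z th) y) y = th ^+ 2 * lap (z th) y) ->
  (forall th : R, 0 < th < 1 -> forall x i, `|'D_(e_ i) (z th) x| <= C) ->
  (forall th : R, 0 < th < 1 -> forall x i,
     `|'D_(e_ i) (H (P + grad (z th) x)) x| <= L) ->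
  s * s = 1 -> 0 < th < 1 -> forall x,
  s * derive1 (fun t : R => t * z t x) th <= n%:R + n%:R * (C * L) + n%:R * C.
Proof.
move=> sH; set D := [set q | _]; set f := fun q => _ => sf pz pde zC HL s2 th01 x.
pose X i := (0, e_ i) : R * 'rV[R]_n.
pose T := (1, 0) : R * 'rV[R]_n.
have [th0 th1] := andP th01.
have gradE t y i : 'D_(e_ i) (z t) y = 'D_(X i) f (t, y).
  exact: (derive_pair_r _ _ _ _ f).
have gradvE t y : grad (z t) y = \row_i 'D_(X i) f (t, y).
  by apply/rowP => i; rewrite !mxE gradE.
have lapE t y : lap (z t) y = \sum_i 'D_(X i) ('D_(X i) f) (t, y).
  apply: eq_bigr => i _.
  have -> : 'D_(e_ i) (z t) = fun y => 'D_(X i) f (t, y).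
    by apply/funext => w; rewrite gradE.
  exact: (derive_pair_r _ _ _ _ ('D_(X i) f)).
have pdef q : D q -> q.1 * f q + H (P + \row_i 'D_(X i) f q) q.2 =
     q.1 * q.1 * \sum_i 'D_(X i) ('D_(X i) f) q.
  case: q => t y /= Dq; have := pde t Dq y.
  by rewrite gradvE lapE expr2.
have df v y : differentiable (fun y => 'D_v f (th, y)) y.
  apply: (differentiable_pair_r _ _ _ _ ('D_v f)).
  apply: (smooth_on_differentiable _ _ D _ _ (smooth_on_derive _ _ D f v sf)).
  exact: th01.
pose G y := s * 'D_T f (th, y) +
  \sum_k 2^-1 * 'D_(X k) f (th, y) * 'D_(X k) f (th, y).
have cG : continuous G.
  move=> y; apply: differentiable_continuous.
  have -> : G = s *: (fun y => 'D_T f (th, y)) +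
      \sum_k ((2^-1 *: (fun y => 'D_(X k) f (th, y))) *
              (fun y => 'D_(X k) f (th, y))).
    by apply/funext => w; rewrite /G [RHS]/(_ + (\sum_k _) _) fct_sumE.
  apply: differentiableD.
    exact/differentiableZ/df.
  apply: differentiable_sum => k; apply: differentiableM.
    exact/differentiableZ/df.
  exact: df.
have timeE y : is_derive th 1 (fun t => z t y) ('D_T f (th, y)).
  apply: (is_derive_pair_l _ _ _ _ f).
  apply/diff_derivable/(smooth_on_differentiable _ _ D _ _ sf); exact: th01.
(* Periodicity holds for all parameters near [th], so it passes to the derivative in the
   parameter. *)
have pT : Zn_periodic (fun y => 'D_T f (th, y)).
  move=> k y /=; rewrite -!(@derive_val _ _ _ _ _ _ _ (timeE _)).
  apply: near_eq_derive.
  have thI : nbhs th (`]0, 1[%classic : set R).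
    by apply: near_in_itvoo; rewrite in_itv.
  by apply: filterS thI => t /=; rewrite in_itv/= => t01; exact: pz.
have pX i : Zn_periodic (fun y => 'D_(X i) f (th, y)).
  move=> k y /=; rewrite -!gradE; exact: (Zn_periodic_derive _ _ _ _ (pz _ th01)).
have pG : Zn_periodic G.
  move=> k y; rewrite /G (pT k y); congr (_ + _).
  by apply: eq_bigr => i _; rewrite (pX i k y).
have [c cmax] := Zn_periodic_max _ _ _ cG pG.
have key := bernstein_at_max R n H P f s th c sH sf pdef s2 th01 cmax.
have osc y y' : z th y - z th y' <= n%:R * C.
  apply: Zn_periodic_osc => //; last by move=> ? ?; exact: zC.
    move=> w; apply: (differentiable_pair_r _ _ _ _ f).
    by apply: (smooth_on_differentiable _ _ D _ _ sf); exact: th01.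
  exact: pz.
(* For [s = -1] the oscillation bound is used with the two points exchanged. *)
have osc_s : s * (z th x - z th c) <= n%:R * C.
  have /orP[/eqP->|/eqP->] : (s == 1) || (s == -1).
    by rewrite -sqrf_eq1 expr2 s2.
    by rewrite mul1r.
  by rewrite mulN1r opprB.
have HS : - \sum_k 'D_(X k) f (th, c) *
      'D_(e_ k) (H (P + \row_i 'D_(X i) f (th, c))) c <= n%:R * (C * L).
  rewrite -gradvE -sumrN.
  have -> : n%:R * (C * L) = \sum_(i < n) (C * L).
    by rewrite sumr_const card_ord mulr_natl.
  apply: ler_sum => k _; apply: le_trans (ler_norm _) _.
  by rewrite normrN normrM -gradE ler_pM// ?zC ?HL.
have Dv : derive1 (fun t => t * z t x) th = z th x + th * 'D_T f (th, x).
  rewrite derive1E (@derive_val _ _ _ _ _ _ _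
    (is_deriveM (is_derive_id th 1) (timeE x))).
  by rewrite addrC; congr (_ + _); exact: mulr1.
have Gx := cmax x.
set Q := \sum_k 'D_(X k) f (th, c) * _ in key.
have Gc : G c = s * 'D_T f (th, c) + 2^-1 * Q.
  rewrite /G /Q mulr_sumr; congr (_ + _); apply: eq_bigr => k _.
  by rewrite mulrA.
have Q0 : 0 <= Q.
  by apply: sumr_ge0 => k _; rewrite -expr2 sqr_ge0.
have Gx' : s * 'D_T f (th, x) <= G x.
  rewrite lerDl; apply: sumr_ge0 => k _.
  by rewrite -mulrA -expr2 mulr_ge0 ?sqr_ge0 ?invr_ge0.
(* Comparing [G] at [x] and [c] costs [th * Q / 2], which the term [th * Q] in [key] absorbs: this
   is why [G] carries the factor one half. *)
have thG : th * (s * 'D_T f (th, x)) <= th * (s * 'D_T f (th, c) + 2^-1 * Q).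
  by rewrite ler_pM2l// -Gc; exact: le_trans Gx.
have thQ : 0 <= th * Q by rewrite mulr_ge0// ltW.
rewrite Dv.
have fE y : f (th, y) = z th y by [].
rewrite fE in key.
move: key osc_s HS thG thQ; clear.
set S := \sum_k _.
move: S ('D_T f (th, x)) ('D_T f (th, c)) (z th x) (z th c).
move=> S wx wc zx zc; lra.
Qed.

Theorem theorem5 (R : realType) (n : nat)
  (H : 'rV[R]_n -> 'rV[R]_n -> R) (P : 'rV[R]_n) (z : R -> 'rV[R]_n -> R) :
  (* H smooth on R^n x R^n *)
  smooth_on setT (fun q : 'rV[R]_n * 'rV[R]_n => H q.1 q.2) ->
  (* Z^n-periodic in y *)
  (forall p, Zn_periodic (H p)) ->
  (* sup_y |H(0,y)| < oo *)
  (exists M : R, forall y, `|H 0 y| <= M) ->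
  (* |D_y H(p,y)| <= C0 (1 + |p|) *)
  (exists C0 : R, forall p y, enorm (grad (H p) y) <= C0 * (1 + enorm p)) ->
  (* H(p,y) -> +oo as |p| -> oo, uniformly in y *)
  (forall M : R, exists R0 : R, forall p y, R0 <= enorm p -> M <= H p y) ->
  (* z depends smoothly on (theta, x) for theta in (0,1) *)
  smooth_on [set q : R * 'rV[R]_n | 0 < q.1 < 1] (fun q => z q.1 q.2) ->
  (* each z^theta is Z^n-periodic and solves the equation *)
  (forall th, 0 < th < 1 -> Zn_periodic (z th)) ->
  (forall th, 0 < th < 1 -> forall y,
     th * z th y + H (P + grad (z th) y) y = th ^+ 2 * lap (z th) y) ->
  (* standard uniform bounds *)
  (exists C : R, forall th, 0 < th < 1 -> forall x,
     `|th * z th x| <= C /\ enorm (grad (z th) x) <= C) ->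
  exists C : R, 0 < C /\
    forall th, 0 < th < 1 -> forall x : 'rV[R]_n,
      `|derive1 (fun t : R => t * z t x) th| <= C.
Proof.
move=> sH _ _ [C0 HC0] _ sz pz pde [C zC].
pose p th x := P + grad (z th) x.
(* [N] bounds each coordinate of the momentum, so [L] bounds the [y]-derivatives of [H] along the
   solutions; the absolute value is taken because the sign of [C0] is unknown. *)
pose N := enorm P + C.
pose L := `|C0| * (1 + Num.sqrt (n%:R * N ^+ 2)).
have DzC (th : R) : 0 < th < 1 -> forall x i, `|'D_(e_ i) (z th) x| <= C.
  move=> th01 x i; have := le_enorm _ _ (grad (z th) x) i.
  by rewrite mxE => /le_trans; apply; exact: (zC th th01 x).2.
have DHL (th : R) : 0 < th < 1 -> forall x i, `|'D_(e_ i) (H (p th x)) x| <= L.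
  move=> th01 x i; have := le_enorm _ _ (grad (H (p th x)) x) i.
  rewrite mxE => /le_trans; apply; apply: le_trans (HC0 (p th x) x) _.
  have e0 (v : 'rV[R]_n) : 0 <= enorm v by exact: sqrtr_ge0.
  apply: (@le_trans _ _ (`|C0| * (1 + enorm (p th x)))).
    by rewrite ler_wpM2r ?ler_norm// addr_ge0.
  rewrite ler_wpM2l// lerD2l; apply: enorm_le => j; rewrite mxE.
  apply: le_trans (ler_normD _ _) _; rewrite lerD ?le_enorm// mxE.
  exact: DzC.
(* Some admissible parameter is needed to read off [0 <= C] from the assumed bounds. *)
have hhalf : 0 < (2^-1 : R) < 1 by rewrite invr_gt0 ltr0n invf_lt1 ?ltr1n.
have C_ge0 : 0 <= C.
  exact: le_trans (normr_ge0 _) (zC _ hhalf 0).1.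
have L_ge0 : 0 <= L by rewrite mulr_ge0// addr_ge0// sqrtr_ge0.
(* The final 1 ensures strict positivity even for [n = 0]. *)
exists (n%:R + n%:R * (C * L) + n%:R * C + 1); split.
  by rewrite ltr_wpDl// !addr_ge0// !mulr_ge0.
move=> th th01 x; rewrite ler_norml.
(* The signs 1 and -1 give the two halves of the absolute value bound. *)
have up s (s2 : s * s = 1) :=
  one_sided_bound R n H P z C L s th sH sz pz pde DzC DHL s2 th01 x.
have := up 1 (mul1r 1); have := up (-1) (etrans (mulrNN 1 1) (mulr1 1)).
rewrite mulN1r !mul1r => h1 h2.
apply/andP; split; last by rewrite (le_trans h2)// lerDl.
by rewrite lerNl (le_trans h1)// lerDl.
Qed.
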